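(* Let $R$ be a ring, and let $N_{1}$ and $N_{2}$ be proper submodules of $R$-modules $M_{1}$ and $M_{2}$, respectively. Regard $M_{1}\times M_{2}$ as an $R$-module with componentwise operations. (1) If $N_{1}\times N_{2}$ is a gsdf-absorbing submodule of $M_{1}\times M_{2}$, then $N_{1}$ and $N_{2}$ are gsdf-absorbing submodules of $M_{1}$ and $M_{2}$, respectively. (2) $N_{1}\times M_{2}$ is a gsdf-absorbing submodule of $M_{1}\times M_{2}$ if and only if $N_{1}$ is a gsdf-absorbing submodule of $M_{1}$. (3) $M_{1}\times N_{2}$ is a gsdf-absorbing submodule of $M_{1}\times M_{2}$ if and only if $N_{2}$ is a gsdf-absorbing submodule of $M_{2}$.
   Context: All rings are commutative with identity $1\neq 0$ and all modules are unital. Let $R$ be a ring and $M$ an $R$-module. A proper submodule $N$ of $M$ is called a generalized square-difference factor absorbing submodule (gsdf-absorbing submodule) if for all $u,v\in R$ and $x\in M$, the condition $(u^{2}-v^{2})x\in N$ implies that $(u-v)x\in N$ or $(u+v)^{k}x\in N$ for some integer $k\geq 1$. *)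

(* Defs.v *)
From mathcomp Require Import all_boot all_algebra.
From mathcomp Require Import boolp classical_sets.

Set Implicit Arguments.
Unset Strict Implicit.
Unset Printing Implicit Defensive.

Import GRing.Theory.
Local Open Scope classical_set_scope.
Local Open Scope ring_scope.

(* Subsets are classical sets, so that arbitrary submodules are covered and
   not only those with a decidable membership test. *)
Definition proper_submodule (R : comNzRingType) (M : lmodType R) (N : set M)
  : Prop :=
  GRing.submod_closed [in N] /\ N <> [set: M].

Definition gsdf_absorbing (R : comNzRingType) (M : lmodType R) (N : set M)
  : Prop :=
  proper_submodule N /\
  forall (u v : R) (x : M), N ((u ^+ 2 - v ^+ 2) *: x) ->
    N ((u - v) *: x) \/ exists2 k : nat, (1 <= k)%N & N ((u + v) ^+ k *: x).

(* Main.v *)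
(** Pulling a gsdf-absorbing submodule back along a linear map preserves the
    absorbing condition, so only properness has to be checked. The coordinate
    injections pull a product [A x B] of submodules back to [A] and to [B], and
    the projections pull [N1] and [N2] back to [N1 x M2] and [M1 x N2]. *)
From HB Require Import structures.
Require Import Defs.
From mathcomp Require Import all_boot all_algebra.
From mathcomp Require Import boolp classical_sets.

Local Open Scope classical_set_scope.
Local Open Scope ring_scope.

Import GRing.Theory.

Lemma gsdf_absorbing_preimage (R : comNzRingType) (M M' : lmodType R)
    (f : {linear M -> M'}) (N : set M') :
  gsdf_absorbing N -> f @^-1` N <> [set: M] -> gsdf_absorbing (f @^-1` N).
Proof.
move=> [[[N0 Nlin] _] Nabs] Nproper; split; first split=> //; first split.
- by rewrite inE /= linear0; move: N0; rewrite inE.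
- move=> a u v; rewrite !inE /= linearP => Nu Nv.
  by have := Nlin a _ _ (mem_set Nu) (mem_set Nv); rewrite inE.
(* Scalars pass through [f], so the absorbing condition of [N] is applied to [f x] with the same [u]
   and [v]; the exponent [k] it gives also serves for [x]. *)
- move=> u v x; rewrite /= linearZ => /Nabs.
  by case=> [Nx | [k k1 Nx]]; [left | right; exists k => //]; rewrite linearZ.
Qed.

Section CoordinateInjections.
Context {R : comNzRingType} {M1 M2 : lmodType R}.

(** Named so that the injections can carry a linear structure and be used as [f] above. *)
Definition pair_inl (x : M1) : (M1 * M2)%type := (x, 0).
Definition pair_inr (y : M2) : (M1 * M2)%type := (0, y).

Lemma pair_inl_is_linear : linear pair_inl.
Proof. by move=> a x y; apply/pair_equal_spec; rewrite /= scaler0 addr0. Qed.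

Lemma pair_inr_is_linear : linear pair_inr.
Proof. by move=> a x y; apply/pair_equal_spec; rewrite /= scaler0 addr0. Qed.

HB.instance Definition _ :=
  GRing.isLinear.Build R M1 (M1 * M2)%type *:%R pair_inl pair_inl_is_linear.
HB.instance Definition _ :=
  GRing.isLinear.Build R M2 (M1 * M2)%type *:%R pair_inr pair_inr_is_linear.

Lemma preimage_pair_inl (A : set M1) (B : set M2) :
  B 0 -> pair_inl @^-1` (A `*` B) = A.
Proof. by move=> B0; apply/seteqP; split=> x //= []. Qed.

Lemma preimage_pair_inr (A : set M1) (B : set M2) :
  A 0 -> pair_inr @^-1` (A `*` B) = B.
Proof. by move=> A0; apply/seteqP; split=> x //= []. Qed.

(** Pullback along [pair_inl]. The assumption [B 0] holds both for [N2] and for all of [M2], so this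
    serves the product of two proper submodules as well as [N1] times [M2]. *)
Lemma gsdf_absorbing_setXl (A : set M1) (B : set M2) :
  A <> [set: M1] -> B 0 ->
  @gsdf_absorbing R (M1 * M2)%type (A `*` B) -> gsdf_absorbing A.
Proof.
move=> AT B0 /(@gsdf_absorbing_preimage _ _ _ pair_inl).
by rewrite preimage_pair_inl //; apply.
Qed.

Lemma gsdf_absorbing_setXr (A : set M1) (B : set M2) :
  A 0 -> B <> [set: M2] ->
  @gsdf_absorbing R (M1 * M2)%type (A `*` B) -> gsdf_absorbing B.
Proof.
move=> A0 BT /(@gsdf_absorbing_preimage _ _ _ pair_inr).
by rewrite preimage_pair_inr //; apply.
Qed.

Lemma gsdf_absorbing_setXT (A : set M1) :
  gsdf_absorbing A -> @gsdf_absorbing R (M1 * M2)%type (A `*` [set: M2]).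
Proof.
move=> gA; have [[_ AT] _] := gA.
have -> : A `*` [set: M2] = fst @^-1` A by apply/seteqP; split=> x //= [].
apply: (@gsdf_absorbing_preimage _ _ _ fst) => // /seteqP[_ TA].
(* Were the preimage everything, it would contain each [(x, 0)], forcing [A] to be all of [M1]. *)
by apply: AT; apply/seteqP; split=> // x _; apply: (TA (x, 0)).
Qed.

Lemma gsdf_absorbing_setTX (B : set M2) :
  gsdf_absorbing B -> @gsdf_absorbing R (M1 * M2)%type ([set: M1] `*` B).
Proof.
move=> gB; have [[_ BT] _] := gB.
have -> : [set: M1] `*` B = snd @^-1` B by apply/seteqP; split=> x //= [].
apply: (@gsdf_absorbing_preimage _ _ _ snd) => // /seteqP[_ TB].
by apply: BT; apply/seteqP; split=> // y _; apply: (TB (0, y)).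
Qed.

End CoordinateInjections.

Theorem proposition3p6 (R : comNzRingType) (M1 M2 : lmodType R)
    (N1 : set M1) (N2 : set M2)
    (hN1 : proper_submodule N1) (hN2 : proper_submodule N2) :
  [/\ @gsdf_absorbing R (M1 * M2)%type (N1 `*` N2) ->
        gsdf_absorbing N1 /\ gsdf_absorbing N2,
      @gsdf_absorbing R (M1 * M2)%type (N1 `*` [set: M2]) <->
        gsdf_absorbing N1
    & @gsdf_absorbing R (M1 * M2)%type ([set: M1] `*` N2) <->
        gsdf_absorbing N2].
Proof.
have [[/set_mem N10 _] N1T] := hN1.
have [[/set_mem N20 _] N2T] := hN2.
split.
- by move=> g; split; [apply: gsdf_absorbing_setXl g | apply: gsdf_absorbing_setXr g].
(* The forward direction takes [B] to be all of [M2], which contains [0] trivially. *)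
- by split; [apply: gsdf_absorbing_setXl | apply: gsdf_absorbing_setXT].
- by split; [apply: gsdf_absorbing_setXr | apply: gsdf_absorbing_setTX].
Qed.
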